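(* Let $n\ge 2$ and let $\mathcal N$ be a binary necklace of length $n$ with $\delta(\mathcal N)=2$. Set $K:=K_2(\mathcal N)$. Then exactly one of the following holds: (i) (HT) $n$ is even and $n/2\in K$. In this case, if $\tau:=\gcd(n,K)$ and $M:=n/\tau$, then $K=\tau(\mathbb Z/n\mathbb Z)\setminus\{0\}$ and $M$ is even; equivalently, $\mathcal N\in\mathcal D_2^{\mathrm{HT}}(n;\tau)$. (ii) (SP) $|K|=2$. Equivalently, $K=\{k,n-k\}$ for a unique $1\le k<n/2$, so $\mathcal N\in\mathcal D_2^{\mathrm{SP}}(n)$. (iii) (SUB) $|K|>2$ and, when $n$ is even, $n/2\notin K$. Then there exists a unique divisor $\tau\mid n$ such that $K=\tau(\mathbb Z/n\mathbb Z)\setminus\{0\}$, and, writing $M:=n/\tau$, $M$ is odd and $M\ge5$; equivalently, $\mathcal N\in\mathcal D_2^{\mathrm{SUB}}(n;\tau)$. Consequently, $\mathcal D_2^{\mathrm{MP}}(n)=\varnothing$ and $\mathcal D_2(n)=\mathcal D_2^{\mathrm{HT}}(n)\,\dot\cup\,\mathcal D_2^{\mathrm{SP}}(n)\,\dot\cup\,\mathcal D_2^{\mathrm{SUB}}(n)$ (disjoint union).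
   Context: Words $w\in\{0,1\}^n$ are indexed by $\mathbb Z/n\mathbb Z$; $(\mathrm{rot}^k w)_i=w_{i-k}$; a binary necklace of length $n$ is a rotation orbit $[w]$. $d_w(k)=|\{i:w_i\ne w_{i-k}\}|$; for $n\ge 2$, $\delta(w)=\min_{1\le k\le n-1}d_w(k)$, $K_2(w)=\{k\in\{1,\dots,n-1\}:d_w(k)=2\}$, identified with a subset of $\mathbb Z/n\mathbb Z\setminus\{0\}$. Both depend only on $\mathcal N=[w]$, and one writes $\delta(\mathcal N),K_2(\mathcal N)$. For $K=\{k_1,\dots,k_r\}$, $\gcd(n,K)=\gcd(n,k_1,\dots,k_r)$. For $\tau\mid n$, $\tau(\mathbb Z/n\mathbb Z)\setminus\{0\}$ is the set of nonzero residues represented by multiples of $\tau$. $\mathcal D_2(n)$: necklaces of length $n$ with $\delta(\mathcal N)=2$. $\mathcal D_2^{\mathrm{HT}}(n)$: those $\mathcal N\in\mathcal D_2(n)$ with $n$ even and $n/2\in K_2(\mathcal N)$; for $n$ even and $\tau\mid n/2$, $\mathcal D_2^{\mathrm{HT}}(n;\tau)$ is the subset with $K_2(\mathcal N)=\tau(\mathbb Z/n\mathbb Z)\setminus\{0\}$. $\mathcal D_2^{\mathrm{SP}}(n)$: those $\mathcal N\in\mathcal D_2(n)$ with $K_2(\mathcal N)=\{k,n-k\}$ for some $1\le k<n/2$. $\mathcal D_2^{\mathrm{SUB}}(n)$: those $\mathcal N\in\mathcal D_2(n)$ with $K_2(\mathcal N)=\tau(\mathbb Z/n\mathbb Z)\setminus\{0\}$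 for some $\tau\mid n$, with $|K_2(\mathcal N)|>2$ and, if $n$ is even, $n/2\notin K_2(\mathcal N)$; $\mathcal D_2^{\mathrm{SUB}}(n;\tau)$ is the subset with that particular $\tau$. $\mathcal D_2^{\mathrm{MP}}(n)$: those $\mathcal N\in\mathcal D_2(n)$ in none of the three preceding classes. *)

(* Defs.v *)
From mathcomp Require Import all_boot all_algebra.

Set Implicit Arguments.
Unset Strict Implicit.
Unset Printing Implicit Defensive.

Import GRing.Theory.
Local Open Scope ring_scope.

(* Positions and shifts live in 'Z_n, which is Z/nZ only for 2 <= n ('Z_0 and
   'Z_1 are Z/2Z); none of the definitions is meaningful for n < 2. *)
Definition word (n : nat) := {ffun 'Z_n -> bool}.

Definition wrot n (k : 'Z_n) (w : word n) : word n := [ffun i => w (i - k)].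

Definition wrot_orbit n (w : word n) : {set word n} :=
  [set wrot k w | k : 'Z_n].

Definition necklace (n : nat) :=
  {N : {set word n} | [exists w, N == wrot_orbit w]}.

Definition wdist n (w : word n) (k : 'Z_n) : nat :=
  #|[set i | w i != w (i - k)]|.

Definition delta n (w : word n) : nat :=
  wdist w [arg min_(k < 1 | k != 0) wdist w k].

Definition K2 n (w : word n) : {set 'Z_n} :=
  [set k | (k != 0) && (wdist w k == 2)%N].

Lemma necklace_ofP n (w : word n) : [exists w', wrot_orbit w == wrot_orbit w'].
Proof. by apply/existsP; exists w. Qed.

Definition necklace_of n (w : word n) : necklace n :=
  exist _ (wrot_orbit w) (necklace_ofP w).

Definition necklace_rep n (N : necklace n) : word n :=
  xchoose (existsP (valP N)).

(* Independence of the representative: ndelta_of and nK2_of below. *)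
Definition ndelta n (N : necklace n) : nat := delta (necklace_rep N).
Definition nK2 n (N : necklace n) : {set 'Z_n} := K2 (necklace_rep N).

Lemma necklace_repK n (N : necklace n) : necklace_of (necklace_rep N) = N.
Proof. by apply/val_inj/esym/eqP; exact: (xchooseP (existsP (valP N))). Qed.

Lemma wdist_rot n (j : 'Z_n) (w : word n) : wdist (wrot j w) =1 wdist w.
Proof.
move=> k; rewrite /wdist.
rewrite -[RHS](card_imset _ (addrI j)); congr #|pred_of_set _|.
apply/setP=> i; rewrite inE !ffunE [i - k - j]addrAC.
apply/idP/imsetP=> [h | [l + ->]]; last by rewrite inE [j + l]addrC addrK.
by exists (i - j); rewrite ?inE // addrC subrK.
Qed.

Lemma necklace_rep_of n (w : word n) :
  exists k, necklace_rep (necklace_of w) = wrot k w.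
Proof.
have := congr1 val (necklace_repK (necklace_of w)) => /= /setP eqo.
have : necklace_rep (necklace_of w) \in wrot_orbit w.
  rewrite -eqo; apply/imsetP; exists 0 => //.
  by apply/ffunP=> i; rewrite ffunE subr0.
by case/imsetP=> k _ ->; exists k.
Qed.

Lemma nK2_of n (w : word n) : nK2 (necklace_of w) = K2 w.
Proof.
rewrite /nK2; have [j ->] := necklace_rep_of w.
by apply/setP=> k; rewrite !inE wdist_rot.
Qed.

Lemma ndelta_of n (w : word n) : ndelta (necklace_of w) = delta w.
Proof.
rewrite /ndelta /delta; have [j ->] := necklace_rep_of w; rewrite wdist_rot.
case: arg_minnP => [|k k0 mink]; first exact: oner_neq0.
case: arg_minnP => [|l l0 minl]; first exact: oner_neq0.
apply/eqP; rewrite eqn_leq minl // andbT.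
by have := mink l l0; rewrite !wdist_rot.
Qed.

Definition gcd_with n (K : {set 'Z_n}) : nat :=
  gcdn n (\big[gcdn/0]_(k in K) (k : nat))%N.

Definition nz_multiples n (tau : nat) : {set 'Z_n} :=
  [set a *+ tau | a : 'Z_n] :\ 0.

Definition contains_half n (K : {set 'Z_n}) : bool := (n./2)%:R \in K.

Definition D2 n : {set necklace n} := [set N | (ndelta N == 2)%N].

Definition D2HT n : {set necklace n} :=
  [set N in D2 n | ~~ odd n & contains_half (nK2 N)].

Definition D2HT_tau n (tau : nat) : {set necklace n} :=
  [set N in D2HT n | (tau %| n./2)%N & nK2 N == nz_multiples n tau].

Definition D2SP n : {set necklace n} :=
  [set N in D2 n | [exists k : 'I_n, [&& (1 <= k)%N, (k.*2 < n)%N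
                                     & nK2 N == [set k%:R; (n - k)%:R]]]].

Definition D2SUB n : {set necklace n} :=
  [set N in D2 n | [&& has (fun tau => nK2 N == nz_multiples n tau) (divisors n),
                       (2 < #|nK2 N|)%N
                     & ~~ odd n ==> ~~ contains_half (nK2 N)]].

Definition D2SUB_tau n (tau : nat) : {set necklace n} :=
  [set N in D2SUB n | (tau %| n)%N & nK2 N == nz_multiples n tau].

Definition D2MP n : {set necklace n} :=
  D2 n :\: (D2HT n :|: D2SP n :|: D2SUB n).

Definition exactly_one (P Q R : Prop) : Prop :=
  [\/ [/\ P, ~ Q & ~ R], [/\ ~ P, Q & ~ R] | [/\ ~ P, ~ Q & R]].

(* Main.v *)
(* The shifts of w are indicator functions of sets of the same size, so d_w(k) = 2
   says that shifting by k moves a single 1 of w.  For k <> l in K, expanding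
   w - T^(k+l) w through T^k w and through T^l w gives two signed sums of four
   point masses; comparing them, either two masses cancel, and then k + l is in
   K or 0, or k = l.  As K = -K, this makes K together with 0 a subgroup of Z/nZ
   unless K = {k, -k} with k <> -k, and the three cases are read off from the
   subgroups of Z/nZ. *)
Require Import Defs.
From mathcomp Require Import all_boot all_algebra zify.

Set Implicit Arguments.
Unset Strict Implicit.
Unset Printing Implicit Defensive.

Import GRing.Theory.

(** * Shift differences of a word as signed sums of point masses *)

Section ShiftDifferences.

Local Open Scope ring_scope.

Variables (n : nat) (w : word n).

Let f (i : 'Z_n) : int := (w i : nat)%:Z.

(* The degenerate case a = b says that w is invariant under k. *)
Definition one_move (k a b : 'Z_n) : Prop :=
  forall i, f i - f (i - k) = (i == b : nat)%:Z - (i == a : nat)%:Z.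

Lemma wdistE k : wdist w k = #|[set i | f i - f (i - k) != 0]|.
Proof.
rewrite /wdist; congr #|pred_of_set _|; apply/setP=> i; rewrite !inE subr_eq0.
by rewrite /f; case: (w i); case: (w (i - k)).
Qed.

Lemma sum_shift_difference k : \sum_i (f i - f (i - k)) = 0.
Proof.
rewrite big_split /= sumrN; apply/eqP; rewrite subr_eq0; apply/eqP.
by rewrite (reindex_inj (addIr (- k))).
Qed.

(** The difference is nonzero at exactly two positions, where it is 1 or -1. It sums to zero over
    all positions, so the two values are opposite. *)
Lemma one_move_wdist2 k : wdist w k = 2%N -> exists a b, one_move k a b.
Proof.
rewrite wdistE => /eqP/cards2P[a [b [ab Dab]]].
have f0 i : i != a -> i != b -> f i - f (i - k) = 0.
  move=> ia ib; apply/eqP/negPn/negP => fi.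
  have : i \in [set i | f i - f (i - k) != 0] by rewrite inE.
  by rewrite Dab !inE (negPf ia) (negPf ib).
have fa : f a - f (a - k) != 0.
  have : a \in [set i | f i - f (i - k) != 0] by rewrite Dab set21.
  by rewrite inE.
have := sum_shift_difference k; rewrite (bigD1 a) //= (bigD1 b) /=; last by rewrite eq_sym.
rewrite big1 => [|i /andP[ia ib]]; last exact: f0.
rewrite addr0 => fab.
have [E|E] : (f a - f (a - k) = 1 \/ f a - f (a - k) = -1).
- by move: fa; rewrite /f; case: (w a); case: (w (a - k)); [|left|right|].
- exists b, a => i; case: (eqVneq i a) => [->|ia]; first by rewrite (negPf ab); lia.
  by case: (eqVneq i b) => [->|ib]; [lia|rewrite f0].
exists a, b => i; case: (eqVneq i a) => [->|ia]; first by rewrite (negPf ab); lia.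
by case: (eqVneq i b) => [->|ib]; [lia|rewrite f0].
Qed.

Lemma one_move_wdist_le2 k a b : one_move k a b -> (wdist w k <= 2)%N.
Proof.
move=> kab; rewrite wdistE.
apply: (@leq_trans #|[set a; b]|); last by rewrite cards2; case: eqP.
apply: subset_leq_card; apply/subsetP => i; rewrite !inE kab.
by case: (i == a); case: (i == b).
Qed.

(** Masses cancel if [a = d + k], [b = c + k], [c = d] or [a = b], and a single move remains.
    Otherwise the two expansions disagree at [a] or at [a + k]. *)
Lemma one_moveD k l a b c d : k != 0 -> l != 0 -> k != l ->
  one_move k a b -> one_move l c d -> exists x y, one_move (k + l) x y.
Proof.
move=> k0 l0 kl kab lcd.
have eqk i : f i - f (i - (k + l)) = ((i == b : nat)%:Z - (i == a : nat)%:Z) +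
    ((i == d + k : nat)%:Z - (i == c + k : nat)%:Z).
  by rewrite -!subr_eq -kab -lcd opprD !addrA subrK.
have eql i : f i - f (i - (k + l)) = ((i == d : nat)%:Z - (i == c : nat)%:Z) +
    ((i == b + l : nat)%:Z - (i == a + l : nat)%:Z).
  by rewrite -!subr_eq -kab -lcd opprD (addrC (- k)) !addrA subrK.
case: (eqVneq a (d + k)) => [ad|ad].
  by exists (c + k), b => i; rewrite eqk -ad; lia.
case: (eqVneq b (c + k)) => [bc|bc].
  by exists a, (d + k) => i; rewrite eqk -bc; lia.
have al : a != a + l by rewrite -subr_eq0 opprD addrA subrr sub0r oppr_eq0.
have ak : a != a + k by rewrite -subr_eq0 opprD addrA subrr sub0r oppr_eq0.
case: (eqVneq c d) => [cd|cd].
  by exists a, b => i; rewrite eqk -cd; lia.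
case: (eqVneq a b) => [ab|ab].
  by exists c, d => i; rewrite eql -ab; lia.
(* At [a] the first expansion is negative; in the second, [a + l] misses this point, so only [c] can
   supply a negative mass. *)
have ac : a = c.
  have := etrans (esym (eqk a)) (eql a).
  rewrite eqxx (negPf ab) (negPf al) (negPf ad).
  by case: (eqVneq a c) => // _; case: (a == c + k); case: (a == d); case: (a == b + l).
(* With [a = c], the first expansion is -1 at [a + k], while both negative masses of the second miss
   this point, that of [a + l] because [k != l]. *)
have := etrans (esym (eqk (a + k))) (eql (a + k)).
rewrite -ac in bc cd *.
rewrite eqxx (eq_sym _ b) (negPf bc) (eq_sym _ a) (negPf ak) (inj_eq (addIr k)) (negPf cd).
rewrite (inj_eq (addrI a)) (negPf kl).
by case: (_ == _); case: (_ == _).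
Qed.

Hypothesis dw : delta w = 2%N.

Lemma wdist_ge2 k : k != 0 -> (2 <= wdist w k)%N.
Proof.
move: dw; rewrite /delta; case: arg_minnP => [|l l0 lmin <- k0]; first exact: oner_neq0.
exact: lmin.
Qed.

Lemma K2_neq0 : K2 w != set0.
Proof.
move: dw; rewrite /delta; case: arg_minnP => [|l l0 lmin l2]; first exact: oner_neq0.
by apply/set0Pn; exists l; rewrite inE l0 l2.
Qed.

(** One move bounds the distance by 2, and [delta w = 2] gives the reverse bound as soon as [k + l]
    is nonzero. *)
Lemma K2_add k l : k \in K2 w -> l \in K2 w -> k != l -> k + l \in 0 |: K2 w.
Proof.
rewrite !inE => /andP[k0 /eqP/one_move_wdist2[a [b kab]]].
move=> /andP[l0 /eqP/one_move_wdist2[c [d lcd]]] kl.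
have [x [y /one_move_wdist_le2 le2]] := one_moveD k0 l0 kl kab lcd.
case: eqVneq => //= kl0; by rewrite eqn_leq le2 wdist_ge2.
Qed.

(** The mismatches for [- k] are those for [k], translated by [- k]. *)
Lemma K2_opp k : k \in K2 w -> - k \in K2 w.
Proof.
rewrite !inE oppr_eq0 => /andP[-> /eqP <-] /=; apply/eqP; rewrite /wdist.
rewrite -(card_imset _ (addIr k)); congr #|pred_of_set _|.
apply/setP=> i; apply/imsetP/idP => [[j + ->]|].
  by rewrite !inE opprK addrK eq_sym.
by rewrite inE => wi; exists (i - k); rewrite ?inE ?opprK ?subrK // eq_sym.
Qed.

End ShiftDifferences.

(** * Symmetric sets closed, up to 0, under sums of distinct elements *)

Section NearSubgroups.

Local Open Scope ring_scope.

Variables (V : finZmodType) (K : {set V}).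
Hypothesis K0 : 0 \notin K.
Hypothesis KN : forall k, k \in K -> - k \in K.
Hypothesis KD : forall k l, k \in K -> l \in K -> k != l -> k + l \in 0 |: K.

Lemma near_subgroup_neq0 k : k \in K -> k != 0.
Proof. by apply: contraTneq => ->. Qed.

(** [KD] is silent on [x + x], so this is reached as [(x + l) + (x - l)]. The two summands coincide
    only if [l = - l]; then [x + (x + l)] is formed first and a further [l] brings it back to
    [x + x]. *)
Lemma near_subgroup_double x l :
  x \in K -> l \in K -> l != x -> l != - x -> x + x \in 0 |: K.
Proof.
move=> xK lK lx lNx.
have addK y z : y \in K -> z \in K -> y != z -> y + z != 0 -> y + z \in K.
  by move=> yK zK yz yz0; have := KD yK zK yz; rewrite !inE (negPf yz0).
have xl : x != l by rewrite eq_sym.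
have xNl : x != - l by rewrite eq_sym eqr_oppLR.
have xlK : x + l \in K by rewrite addK // addr_eq0.
have xNlK : x - l \in K by rewrite addK ?KN // subr_eq0.
case: (eqVneq (x + l) (x - l)) => [/addrI lNl|xlN]; last first.
  by have := KD xlK xNlK xlN; rewrite addrACA subrr addr0.
have l0 := near_subgroup_neq0 lK.
have x_xl : x != x + l by rewrite -subr_eq0 opprD addrA subrr sub0r oppr_eq0.
have := KD xK xlK x_xl; rewrite addrA !inE addr_eq0 -lNl => /orP[/eqP ->|xxlK].
  by rewrite lK orbT.
case: (eqVneq (x + x) 0) => //= xx0.
have xxl : x + x + l != l by rewrite -subr_eq0 addrK.
have ll0 : l + l = 0 by rewrite {2}lNl subrr.
by have := KD xxlK lK xxl; rewrite -[x + x + l + l]addrA ll0 addr0 !inE (negPf xx0).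
Qed.

(** Only doubling is left. Without an element outside [x] and [- x], the set is [[set x; - x]]; its
    size is not 2, so [x = - x] and the double is 0. *)
Lemma near_subgroup_closed : #|K| != 2%N ->
  forall x y, x \in 0 |: K -> y \in 0 |: K -> x + y \in 0 |: K.
Proof.
move=> cK x y; rewrite !inE => /predU1P[->|xK] /predU1P[->|yK].
- by rewrite add0r eqxx.
- by rewrite add0r yK orbT.
- by rewrite addr0 xK orbT.
case: (eqVneq x y) => [<-|xy]; last by have := KD xK yK xy; rewrite !inE.
case: (boolP (K \subset [set x; - x])) => [sK|/subsetPn[l lK]].
  have EK : K = [set x; - x].
    by apply/eqP; rewrite eqEsubset sK; apply/subsetP => z /set2P[]->; rewrite ?KN.
  move: cK; rewrite EK cards2; case: (eqVneq x (- x)) => //= /eqP xNx _.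
  by rewrite addr_eq0 xNx.
rewrite !inE negb_or => /andP[lx lNx].
by have := near_subgroup_double xK lK lx lNx; rewrite !inE.
Qed.

End NearSubgroups.

(** * Subgroups of Z/nZ as multiples of a divisor of [n] *)

Section ZnSubgroups.

Local Open Scope ring_scope.

Variable n : nat.
Hypothesis n_gt1 : (1 < n)%N.

Lemma Zp_nat_eq0 k : ((k%:R : 'Z_n) == 0) = (n %| k)%N.
Proof. by rewrite -val_eqE /= val_Zp_nat. Qed.

Lemma ltn_Zp (x : 'Z_n) : (x < n)%N.
Proof. by rewrite -[n in (_ < n)%N](Zp_cast n_gt1). Qed.

Lemma Zp_val_eq0 (x : 'Z_n) : (x == 0) = (x == 0 :> nat)%N.
Proof. by []. Qed.

(** The representative satisfies [0 < 2x < 2n] and [n] divides [2x], which forces [2x = n]. *)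
Lemma Zp_double_eq0 (x : 'Z_n) : x != 0 -> x + x = 0 ->
  ~~ odd n /\ x = (n./2)%:R.
Proof.
rewrite -{2 3 4}[x]natr_Zp -natrD Zp_val_eq0 => x0 /eqP.
rewrite Zp_nat_eq0 => /dvdnP[q E]; have := ltn_Zp x.
have q1 : q = 1%N by move: (ltn_Zp x) E x0; case: q => [|[|q]] //; nia.
have nx : n./2 = x by lia.
by split; [lia|rewrite nx natr_Zp].
Qed.

Lemma mem_nz_multiples t (x : 'Z_n) : (t %| n)%N ->
  (x \in nz_multiples n t) = (x != 0) && (t %| x)%N.
Proof.
move=> tn; rewrite !inE; congr (_ && _); apply/imsetP/idP => [[a _ ->]|/dvdnP[q E]].
  rewrite -[a]natr_Zp -mulrnA val_Zp_nat //.
  by rewrite /dvdn modn_dvdm // -/(dvdn _ _) dvdn_mull.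
by exists q%:R => //; rewrite -mulrnA -E natr_Zp.
Qed.

Lemma dvdn_gcd_with d (K : {set 'Z_n}) :
  (d %| gcd_with K)%N = (d %| n)%N && [forall k in K, d %| (k : nat)]%N.
Proof.
rewrite dvdn_gcd; congr (_ && _).
apply/dvdn_biggcdP/forall_inP => H k /H; exact.
Qed.

(** This recovers a divisor from its set of multiples, whence the uniqueness of [tau]. *)
Lemma gcd_with_nz_multiples t : (t %| n)%N -> gcd_with (nz_multiples n t) = t.
Proof.
move=> tn; apply/eqP; rewrite eqn_dvd dvdn_gcd_with tn /=; apply/andP; split; last first.
  by apply/forall_inP => k; rewrite mem_nz_multiples // => /andP[].
have := dvdn_gcd_with (gcd_with (nz_multiples n t)) (nz_multiples n t).
rewrite dvdnn => /esym/andP[gn /forall_inP H].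
(* For [t = n] the set is empty and only the leading [n] of [gcd_with] remains; for [t < n] the
   residue of [t] is itself an element. *)
have [tE|t_neq_n] := eqVneq t n; first by rewrite [X in (_ %| X)%N]tE.
have lt_tn : (t < n)%N by rewrite ltn_neqAle t_neq_n dvdn_leq // ltnW.
have t0 : (0 < t)%N by rewrite (dvdn_gt0 _ tn) // ltnW.
have := H t%:R; rewrite mem_nz_multiples // Zp_nat_eq0 val_Zp_nat // modn_small //.
by rewrite gtnNdvd // dvdnn; exact.
Qed.

Lemma add_closed_nz_multiples (K : {set 'Z_n}) : 0 \notin K ->
    (forall x y, x \in 0 |: K -> y \in 0 |: K -> x + y \in 0 |: K) ->
  K = nz_multiples n (gcd_with K).
Proof.
move=> K0 KD.
have KM x m : x \in 0 |: K -> x *+ m \in 0 |: K.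
  by move=> xK; elim: m => [|m IH]; rewrite ?setU11 // mulrS KD.
have Kgcd a b : (a%:R : 'Z_n) \in 0 |: K -> (b%:R : 'Z_n) \in 0 |: K ->
    ((gcdn a b)%:R : 'Z_n) \in 0 |: K.
  move=> aK bK; case: (posnP b) => [->|b0]; first by rewrite gcdn0.
  case: (Bezoutr a b0) => c _ /dvdnP[q E].
  (* Bezout gives [gcdn a b + c * a = q * b]. As only sums are available, [- (c * a)] is replaced by
     [n.-1] copies of [c * a]. *)
  have -> : (gcdn a b)%:R = (b%:R *+ q) + ((a%:R *+ c) *+ n.-1) :> 'Z_n.
    rewrite -[_ *+ n.-1]addr0.
    have nc : (a%:R *+ c) *+ n.-1 + (a%:R *+ c) = 0 :> 'Z_n.
      rewrite -mulrSr prednK; last exact: ltnW.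
      by rewrite -[LHS]mulr_natr pchar_Zp ?mulr0.
    apply: (addIr (a%:R *+ c)); rewrite addr0 -addrA nc addr0.
    by rewrite -!mulrnA -natrD (mulnC a) E mulnC.
  by apply: KD; [exact: KM | exact/KM/KM].
have gK : ((gcd_with K)%:R : 'Z_n) \in 0 |: K.
  (* The leading [n] of [gcd_with] is the residue 0, which belongs to [0 |: K]. *)
  apply: (Kgcd n); first by rewrite pchar_Zp // setU11.
  elim/big_ind: _ => [|a b|k kK]; [by rewrite setU11|exact: Kgcd|].
  by rewrite natr_Zp inE kK orbT.
have := dvdn_gcd_with (gcd_with K) K.
rewrite dvdnn => /esym/andP[gn /forall_inP H].
apply/setP => x; rewrite mem_nz_multiples //; apply/idP/andP => [xK|[x0 /dvdnP[q E]]].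
  by split; [apply: contraNneq K0 => <-|apply: H].
have : x \in 0 |: K by rewrite -[x]natr_Zp E natrM mulr_natl KM.
by rewrite !inE (negPf x0).
Qed.

(** The index [i] below [(n %/ t).-1] is matched with the residue of [i.+1 * t]. *)
Lemma card_nz_multiples t : (t %| n)%N -> #|nz_multiples n t| = (n %/ t).-1.
Proof.
move=> tn; have t0 : (0 < t)%N by rewrite (dvdn_gt0 _ tn) // ltnW.
have lt_n (i : 'I_(n %/ t).-1) : (i.+1 * t < n)%N.
  by rewrite -ltn_divRL //; have := ltn_ord i; lia.
rewrite -[RHS]card_ord -(@card_imset _ _ (fun i : 'I_(n %/ t).-1 => (i.+1 * t)%:R : 'Z_n)).
  congr #|pred_of_set _|; apply/setP => x; rewrite mem_nz_multiples //.
  apply/andP/imsetP => [[]|[i _ ->]]; last first.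
    rewrite Zp_nat_eq0 gtnNdvd ?muln_gt0 //; split=> //.
    by rewrite val_Zp_nat // modn_small // dvdn_mull.
  rewrite Zp_val_eq0 => x0 /dvdnP[[|q] E]; first by rewrite E in x0.
  have qi : (q < (n %/ t).-1)%N.
    have := ltn_Zp x; rewrite E -ltn_divRL //; lia.
  by exists (Ordinal qi) => //=; rewrite -E natr_Zp.
move=> i j /(congr1 val) /=; rewrite !val_Zp_nat // !modn_small // => /eqP.
by rewrite eqn_pmul2r // eqSS => /eqP/val_inj.
Qed.

(** For odd [n] the rounded [n./2] may lie in the set by accident, hence the parity conjunct. For
    even [n], [n./2 = q * t] amounts to [n = 2q * t]. *)
Lemma half_nz_multiples t : (t %| n)%N ->
  ~~ odd n && contains_half (nz_multiples n t) = ~~ odd (n %/ t).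
Proof.
move=> tn; have t0 : (0 < t)%N by rewrite (dvdn_gt0 _ tn) // ltnW.
have n2 : (0 < n./2 < n)%N by lia.
case/andP: n2 => n20 n2n.
rewrite /contains_half mem_nz_multiples // Zp_nat_eq0 gtnNdvd // val_Zp_nat //=.
rewrite modn_small //; apply/andP/idP => [[en /dvdnP[q E]]|].
  have -> : n = (q.*2 * t)%N by rewrite -doubleMl -E even_halfK.
  by rewrite mulnK // odd_double.
move=> eM; have nE : n = ((n %/ t)./2 * t).*2 by rewrite doubleMl even_halfK // divnK.
by rewrite {1 2}nE odd_double doubleK dvdn_mull.
Qed.

End ZnSubgroups.

(** * The shape of [nK2 N] and the three classes *)

Section NecklaceClasses.

Local Open Scope ring_scope.

Variable n : nat.
Hypothesis n_gt1 : (1 < n)%N.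

Lemma half_double_eq0 : ~~ odd n ->
  ((n./2)%:R != 0 :> 'Z_n) /\ (n./2)%:R + (n./2)%:R = 0 :> 'Z_n.
Proof.
move=> en; split; last by rewrite -natrD addnn even_halfK // pchar_Zp.
by rewrite Zp_nat_eq0 // gtnNdvd //; lia.
Qed.

Lemma Zp_natrB (k : nat) : (k <= n)%N -> ((n - k)%:R : 'Z_n) = - k%:R.
Proof. by move=> kn; rewrite natrB // pchar_Zp // sub0r. Qed.

Lemma pair_shift_inj (k l : nat) : (0 < k)%N -> (k.*2 < n)%N ->
    (0 < l)%N -> (l.*2 < n)%N ->
  (k%:R : 'Z_n) \in [set l%:R; (n - l)%:R] -> k = l.
Proof.
move=> k0 kn l0 ln; rewrite !inE -!val_eqE /= !val_Zp_nat // !modn_small; lia.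
Qed.

Lemma card_pair_shift (k : nat) : (0 < k)%N -> (k.*2 < n)%N ->
  #|[set k%:R; (n - k)%:R] : {set 'Z_n}| = 2%N.
Proof.
move=> k0 kn; rewrite cards2 -val_eqE /= !val_Zp_nat // !modn_small; lia.
Qed.

(** If [x] were its own opposite, the other element would be too, but Z/nZ has at most one element
    of order two. *)
Lemma symmetric_card2 (K : {set 'Z_n}) : 0 \notin K ->
    (forall k, k \in K -> - k \in K) -> #|K| = 2%N ->
  forall x, x \in K -> x + x != 0 /\ K = [set x; - x].
Proof.
move=> K0 KN cK x xK.
have neq0 k : k \in K -> k != 0 by apply: contraTneq => ->.
have pairK y : y \in K -> y != x -> K = [set x; y].
  move=> yK yx; apply/eqP; rewrite eq_sym eqEcard cK cards2 eq_sym yx andbT.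
  by apply/subsetP => z /set2P[]->.
have xx0 : x + x != 0; last first.
  by split=> //; apply: pairK; rewrite ?KN // eq_sym -addr_eq0.
apply/negP => /eqP xx0.
have [y yK] : exists2 y, y \in K & y \notin [set x].
  by apply/subsetPn; apply/negP => /subset_leq_card; rewrite cK cards1.
rewrite inE => yx; have := KN _ yK; rewrite (pairK y yK yx) => /set2P[Ny|Ny].
  by case/eqP: yx; rewrite -[y]opprK Ny; apply/esym/eqP; rewrite -addr_eq0 xx0.
have yy0 : y + y = 0 by rewrite -{1}Ny addNr.
have [_ xh] := Zp_double_eq0 n_gt1 (neq0 _ xK) xx0.
have [_ yh] := Zp_double_eq0 n_gt1 (neq0 _ yK) yy0.
by case/eqP: yx; rewrite yh.
Qed.

Lemma symmetric_card2_shift (K : {set 'Z_n}) : 0 \notin K ->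
    (forall k, k \in K -> - k \in K) -> #|K| = 2%N ->
  exists k : nat, [/\ (0 < k)%N, (k.*2 < n)%N & K = [set k%:R; (n - k)%:R]].
Proof.
move=> K0 KN cK; have /card_gt0P[x xK] : (0 < #|K|)%N by rewrite cK.
have [xx0 EK] := symmetric_card2 K0 KN cK xK.
have x_lt := ltn_Zp n_gt1 x.
have x_gt0 : (0 < x)%N by rewrite lt0n; apply: contraNneq xx0 => x0; rewrite -[x]natr_Zp x0 addr0.
have x2 : (x.*2 != n)%N.
  by apply: contraNneq xx0 => x2; rewrite -[x]natr_Zp -natrD addnn x2 pchar_Zp.
(* Since [x.*2 = n] is excluded, exactly one of [x] and [- x] has its representative below half of
   [n]. *)
have [lt_x2|le_n] := ltnP x.*2 n.
  by exists x; split=> //; rewrite Zp_natrB 1?ltnW // natr_Zp.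
exists (n - x)%N; split; [lia|lia|].
by rewrite subKn 1?ltnW // Zp_natrB 1?ltnW // natr_Zp setUC.
Qed.

Variable N : necklace n.
Hypothesis dN : ndelta N = 2%N.

Lemma nK2_0 : 0 \notin nK2 N.
Proof. by rewrite inE eqxx. Qed.

Lemma nK2_opp k : k \in nK2 N -> - k \in nK2 N.
Proof. exact: K2_opp. Qed.

Lemma nK2_multiples : #|nK2 N| != 2%N ->
  nK2 N = nz_multiples n (gcd_with (nK2 N)).
Proof.
move=> cK; apply: add_closed_nz_multiples => //; first exact: nK2_0.
by apply: near_subgroup_closed cK => [|k|k l]; [exact: nK2_0|exact: nK2_opp|exact: K2_add].
Qed.

Lemma half_card_nK2 : ~~ odd n -> contains_half (nK2 N) -> #|nK2 N| != 2%N.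
Proof.
move=> en hK; apply/eqP => cK.
have [/eqP] := symmetric_card2 nK2_0 nK2_opp cK hK.
by have [_ ->] := half_double_eq0 en.
Qed.

(** The set is nonempty because the minimum 2 is attained; a single element would be its own
    opposite, hence [n./2]. *)
Lemma nK2_card_gt2 : #|nK2 N| != 2%N ->
  (~~ odd n -> ~~ contains_half (nK2 N)) -> (2 < #|nK2 N|)%N.
Proof.
move=> cK nh; have : nK2 N != set0 by exact: K2_neq0.
rewrite -card_gt0; case E : #|nK2 N| cK => [|[|[|]]] // _ _.
have /cards1P[x Ex] : #|nK2 N| == 1%N by rewrite E.
have xK : x \in nK2 N by rewrite Ex set11.
have x0 : x != 0 by apply: contraTneq xK => ->; exact: nK2_0.
have := nK2_opp xK; rewrite {1}Ex inE => /eqP Nx.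
have xx0 : x + x = 0 by rewrite -{1}Nx addNr.
have [en xh] := Zp_double_eq0 n_gt1 x0 xx0.
by have := nh en; rewrite /contains_half -xh xK.
Qed.

Lemma D2HT_E : (N \in D2HT n) = ~~ odd n && contains_half (nK2 N).
Proof. by rewrite !inE dN eqxx. Qed.

Lemma D2SP_E : (N \in D2SP n) = (#|nK2 N| == 2%N).
Proof.
rewrite !inE dN eqxx /=; apply/existsP/eqP => [[k /and3P[k0 kn /eqP ->]]|cK].
  exact: card_pair_shift.
have [k [k0 kn EK]] := symmetric_card2_shift nK2_0 nK2_opp cK.
have lt_k : (k < n)%N by lia.
by exists (Ordinal lt_k); rewrite /= k0 kn EK eqxx.
Qed.

(** The divisor demanded by the definition always exists: [gcd_with (nK2 N)] serves. *)
Lemma D2SUB_E : (N \in D2SUB n) =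
  (2 < #|nK2 N|)%N && (~~ odd n ==> ~~ contains_half (nK2 N)).
Proof.
rewrite !inE dN eqxx /=; apply/idP/idP => [/andP[]//|/andP[cK ->]].
rewrite cK !andbT; apply/hasP; exists (gcd_with (nK2 N)); last first.
  by rewrite -nK2_multiples // neq_ltn cK orbT.
by rewrite -dvdn_divisors ?(ltnW n_gt1) // dvdn_gcdl.
Qed.

Lemma D2_trichotomy :
  exactly_one (N \in D2HT n) (N \in D2SP n) (N \in D2SUB n).
Proof.
rewrite /exactly_one D2HT_E D2SP_E D2SUB_E.
have [/andP[en hK]|nHT] := boolP (~~ odd n && contains_half (nK2 N)).
  by constructor 1; split=> //; rewrite ?(negPf (half_card_nK2 en hK)) // en hK andbF.
have nh : ~~ odd n -> ~~ contains_half (nK2 N) by move=> en; rewrite en in nHT.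
have [cK|cK] := eqVneq #|nK2 N| 2%N.
  by constructor 2; rewrite cK ltnn.
by constructor 3; rewrite nK2_card_gt2 //; split=> //; apply/implyP.
Qed.

End NecklaceClasses.

Theorem theorem4p6 (n : nat) (hn : 2 <= n) :
  (forall N : necklace n, ndelta N = 2 ->
    let K := nK2 N in
    let HT := ~~ odd n /\ contains_half K in
    let SP := #|K| = 2 in
    let SUB := 2 < #|K| /\ (~~ odd n -> ~~ contains_half K) in
    [/\ exactly_one HT SP SUB,
        (let tau := gcd_with K in
         let M := n %/ tau in
         [<-> HT;
              K = nz_multiples n tau /\ ~~ odd M;
              N \in D2HT_tau n tau]),
        [<-> SP;
             exists! k : nat,
               [/\ 1 <= k, k.*2 < n & K = [set k%:R; (n - k)%:R]%R];
             N \in D2SP n],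
        (SUB -> exists tau : nat,
           [/\ unique (fun t : nat => t %| n /\ K = nz_multiples n t) tau,
               odd (n %/ tau),
               5 <= n %/ tau &
               N \in D2SUB_tau n tau])
      & (forall tau : nat, tau %| n ->
           [/\ K = nz_multiples n tau, odd (n %/ tau) & 5 <= n %/ tau]
           <-> N \in D2SUB_tau n tau)])
  /\ D2MP n = set0
  /\ D2 n = D2HT n :|: D2SP n :|: D2SUB n
  /\ [/\ [disjoint D2HT n & D2SP n],
         [disjoint D2HT n & D2SUB n]
       & [disjoint D2SP n & D2SUB n]].
Proof.
split; last first.
  have class_D2 N : [/\ N \in D2HT n -> N \in D2 n, N \in D2SP n -> N \in D2 n
                      & N \in D2SUB n -> N \in D2 n].
    by split; rewrite in_set => /andP[].
  have tri N : N \in D2 n -> exactly_one (N \in D2HT n) (N \in D2SP n) (N \in D2SUB n).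
    by rewrite in_set => /eqP dN; apply: D2_trichotomy.
  have D2E : D2 n = D2HT n :|: D2SP n :|: D2SUB n.
    apply/setP => N; rewrite in_setU in_setU; apply/idP/idP => [/tri|].
      by case=> -[]; do ?[move=> -> | move=> _]; rewrite ?orbT.
    by have [h s u] := class_D2 N; case/orP => [/orP[]|].
  split; first by rewrite /D2MP -D2E setDv.
  split=> //; split; apply/pred0P => N /=; apply/negP => /andP[];
    have [h s u] := class_D2 N.
  - by move=> hN sN; case: (tri N (h hN)) => -[].
  - by move=> hN uN; case: (tri N (h hN)) => -[].
  - by move=> sN uN; case: (tri N (s sN)) => -[].
move=> N dN K HT SP SUB.
have HTE : HT <-> N \in D2HT n by rewrite D2HT_E //; split=> /andP.
have SPE : SP <-> N \in D2SP n by rewrite D2SP_E //; split=> /eqP.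
have SUBE : SUB <-> N \in D2SUB n.
  rewrite D2SUB_E //; split=> [[-> nh]|/andP[cK /implyP nh]] //; exact/implyP.
have n0 : 0 < n := ltnW hn.
have gn : gcd_with K %| n by exact: dvdn_gcdl.
have SUB_tau : SUB -> [/\ K = nz_multiples n (gcd_with K),
    odd (n %/ gcd_with K) & 5 <= n %/ gcd_with K].
  move=> [cK nh]; have EK : K = nz_multiples n (gcd_with K) := nK2_multiples hn dN (negbT (gtn_eqF cK)).
  have oM : odd (n %/ gcd_with K).
    apply/negPn; rewrite -half_nz_multiples // -EK.
    by apply/negP => /andP[en]; apply/negP/nh.
  (* With [M = n %/ gcd_with K], the size of [K] is [M - 1 > 2], so [M > 3], and an odd [M] is then
     at least 5. *)
  have := cK; rewrite {1}EK card_nz_multiples // => M3; split=> //.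
  by move: oM M3; case: (n %/ _) => [|[|[|[|[|]]]]].
split.
- have := D2_trichotomy hn dN; clear -HTE SPE SUBE; clearbody HT SP SUB.
  by case=> -[? ? ?]; [constructor 1|constructor 2|constructor 3]; split; tauto.
- move=> tau M; tfae.
  + move=> [en hK]; have EK : K = nz_multiples n (gcd_with K) := nK2_multiples hn dN (half_card_nK2 hn en hK).
    by split=> //; rewrite -half_nz_multiples // -EK en.
  + move=> [EK eM]; have := half_nz_multiples hn gn; rewrite -EK eM => hK.
    rewrite in_set D2HT_E // -/K hK -EK eqxx andbT.
    (* This gives [n./2 = M./2 * tau], hence the divisibility required by [D2HT_tau]. *)
    have En : n = (M./2 * tau).*2 by rewrite doubleMl even_halfK // divnK.
    by rewrite [in X in _ %| X]En doubleK dvdn_mull.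
  + by rewrite in_set => /andP[/HTE].
- tfae.
  + move=> cK; have [k [k0 kn EK]] := symmetric_card2_shift hn (nK2_0 N) (@nK2_opp _ N) cK.
    exists k; split=> // l [l0 ln EK']; apply: (pair_shift_inj hn) => //.
    by rewrite -EK' /K EK set21.
  + by case=> k [[k0 kn EK] _]; apply/SPE; rewrite /SP EK card_pair_shift.
  + by move/SPE.
- move=> hSUB; have [EK oM M5] := SUB_tau hSUB.
  exists (gcd_with K); split=> //.
    by split=> // t [tn Et]; rewrite Et gcd_with_nz_multiples.
  by rewrite in_set gn -EK eqxx !andbT; apply/SUBE.
move=> tau taun; split=> [[EK oM M5]|].
  rewrite in_set taun -EK eqxx !andbT; apply/SUBE; split.
    by rewrite EK card_nz_multiples //; lia.
  move=> en; have := half_nz_multiples hn taun.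
  by rewrite -EK en oM /= => ->.
rewrite in_set => /andP[/SUBE/SUB_tau[EK oM M5] /andP[_ /eqP Et]].
(* [SUB_tau] speaks of the gcd of [K], which has to be identified with the given [tau]. *)
have Eg : gcd_with K = tau by rewrite /K Et gcd_with_nz_multiples.
by rewrite -Eg.
Qed.
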